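(* Let $G=(V,E)$ be a complete bipartite graph, where the bipartition of vertices is given by $V=I\cup J$. Then a complete description of the IUC polytope $\mathscr{P}_{IUC}(G)$ associated with $G$ is given by the family of double-star inequalities for all double-star subgraphs of $G$ together with the variable bounds $0\le x_v\le 1$, $v\in V$.
   Context: All graphs are finite, simple and undirected. A subset $U\subseteq V$ of the vertices of $G=(V,E)$ is an independent union of cliques (IUC) if every connected component of the induced subgraph $G[U]$ is a complete graph. The IUC polytope $\mathscr{P}_{IUC}(G)\subseteq\mathbb{R}^{V}$ is the convex hull of the incidence vectors of all IUCs of $G$. A double-star subgraph of $G$ is an induced complete bipartite subgraph $K_{|L|,2}$ consisting of two non-adjacent hub vertices $h,u$ and a joint set $L$ of pairwise non-adjacent leaves, $|L|\ge 2$, such that both $h$ and $u$ are adjacent to every vertex of $L$. The double-star inequalities of this subgraph are $$\sum_{i\in L}x_i+(|L|-1)x_h+x_u\le |L|\quad\text{and}\quad \sum_{i\in L}x_i+x_h+(|L|-1)x_u\le |L|.$$ In the complete bipartite graph $G$ with bipartition $V=I\cup J$, the double-star subgraphs are those with hubs $\{j',j''\}\subseteq J$ and leaf set $I'\subseteq I$, $|I'|\ge 2$, and those with hubs $\{i',i''\}\subseteq I$ and leaf set $J'\subseteq J$, $|J'|\ge 2$.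
   Formalization: Stars with one side of the bipartition of size 1 and the other of size at least 2 are excluded: they have no double-star subgraphs, so the description would be the whole cube, whose all-ones point is not in the IUC polytope. *)

(* Defs.v *)
From HB Require Import structures.
From mathcomp Require Import all_boot all_order all_algebra.
From mathcomp Require Import boolp classical_sets reals convex.

Set Implicit Arguments.
Unset Strict Implicit.
Unset Printing Implicit Defensive.

Import Order.TTheory GRing.Theory Num.Theory.

Local Open Scope ring_scope.

Record sgraph := SGraph {
  vertex :> finType;
  adj : rel vertex;
  adj_sym : symmetric adj;
  adj_irrefl : irreflexive adj
}.

Section Graphs.
Variable G : sgraph.
Implicit Types (U L I J : {set G}) (h u : G).

(* The edge relation of G[U], kept on the vertex type of G. *)
Definition induced_adj U : rel G :=
  [rel x y | [&& x \in U, y \in U & adj x y]].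

(* The vertex sets of the connected components of G[U]; [connect] is the
   reflexive transitive closure, an equivalence here since [adj] is
   symmetric. *)
Definition components U : {set {set G}} :=
  equivalence_partition (connect (induced_adj U)) U.

Definition clique U : bool :=
  [forall x in U, forall y in U, (x != y) ==> adj x y].

Definition stable U : bool :=
  [forall x in U, forall y in U, ~~ adj x y].

Definition IUC U : bool := [forall C in components U, clique C].

(* Irreflexivity of [adj] makes h and u lie outside L. *)
Definition double_star h u L : bool :=
  [&& h != u, ~~ adj h u, (2 <= #|L|)%N, stable L
    & [forall i in L, adj h i && adj u i]].

(* I or J may be empty. *)
Definition complete_bipartite I J : Prop :=
  [/\ I :|: J = [set: G], [disjoint I & J]
    & forall x y, adj x y =
        (x \in I) && (y \in J) || (x \in J) && (y \in I)].

End Graphs.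

Section Polytopes.
Local Open Scope classical_set_scope.

Variables (R : realType) (G : sgraph).
Implicit Types (U L : {set G}) (h u : G).

(* Points of R^V; [R^o] is R as a module over itself, which is what makes this
   type an [lmodType R]. *)
Definition incidence U : {ffun G -> R^o} := [ffun v => (v \in U)%:R].

Definition convex_hull (E : lmodType R) (A : set E) : set E :=
  smallest (@convex_set R E) A.

Definition IUC_polytope : set {ffun G -> R^o} :=
  convex_hull [set incidence U | U in [set U : {set G} | IUC U]].

Definition double_star_ineqs h u L (x : G -> R) : Prop :=
  \sum_(i in L) x i + (#|L|%:R - 1) * x h + x u <= #|L|%:R /\
  \sum_(i in L) x i + x h + (#|L|%:R - 1) * x u <= #|L|%:R.

Definition double_star_polyhedron : set {ffun G -> R^o} :=
  [set x : {ffun G -> R^o} | (forall v, 0 <= (x v : R) <= 1) /\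
    (forall h u L, double_star h u L -> double_star_ineqs h u L x)].

End Polytopes.

Arguments IUC_polytope : clear implicits.
Arguments double_star_polyhedron : clear implicits.

(* Main.v *)
(** The IUCs of a complete bipartite graph are the subsets of I, the subsets of
J and the edges.  Let i1, j1 maximize x on I, J, and let i2, j2 be runners-up.
The double-star inequality with hubs i1, i2 and leaves j1, j2 says that
x_i1 + x_i2 + x_j1 + x_j2 <= 2, so x_i2 + x_j1 <= 1 or x_j2 + x_i1 <= 1, and by
symmetry we may assume the former.  Then x is a convex combination in which
every edge used contains i1: the edge {i1, j} gets weight
b_j = max(0, x_j - (1 - x_i1)); with w the sum of the b_j, subsets of I get
total weight x_i1 - w and subsets of J get 1 - x_i1.  The only nontrivial
condition is w <= x_i1 - x_i for i != i1 in I, which is the double-star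
inequality with hubs i1, i and leaves {j | b_j > 0}, or the assumption
x_i2 + x_j1 <= 1 when there is just one such j. *)

Require Import Defs.
From HB Require Import structures.
From mathcomp Require Import all_boot all_order all_algebra.
From mathcomp Require Import boolp classical_sets reals convex.
From mathcomp Require Import interval_inference.
From mathcomp Require Import zify lra.

Set Implicit Arguments.
Unset Strict Implicit.
Unset Printing Implicit Defensive.

Import Order.TTheory GRing.Theory Num.Theory.

Local Open Scope ring_scope.
Local Open Scope classical_set_scope.

(** * IUCs as vertex sets inducing no path on three vertices *)

Section IUCGraphs.
Variable G : sgraph.
Implicit Types (U V : {set G}).

(** If [adj x y] and [adj y z], then [z] lies in the component of [x], a clique. Conversely,
    shortcutting a path of [G[U]] vertex by vertex makes its ends equal or adjacent. Later proofs
    use this local form instead of components. *)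
Lemma IUCP U :
  reflect {in U & &, forall x y z, adj x y -> adj y z -> x != z -> adj x z}
          (IUC U).
Proof.
apply: (iffP forallP) => [UC x y z xU yU zU xy yz xz | P3U C].
  pose C := [set t in U | connect (induced_adj U) x t]%SET.
  have CU : C \in components U by apply/imsetP; exists x.
  have /implyP/(_ CU)/forallP/(_ x)/implyP := UC C.
  rewrite inE xU connect0 => /(_ isT)/forallP/(_ z)/implyP.
  rewrite inE zU xz /=; apply.
  by apply: (@connect_trans _ _ y); apply: connect1;
    rewrite /induced_adj/= ?xU ?yU ?zU ?xy ?yz.
apply/implyP => /imsetP[x xU ->].
apply/forallP => y; apply/implyP; rewrite inE => /andP[yU xy].
apply/forallP => z; apply/implyP; rewrite inE => /andP[zU xz].
have esym : connect_sym (induced_adj U).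
  by apply: sym_connect_sym => u v; rewrite /induced_adj/= andbCA adj_sym.
have /connectP[p yp ->] : connect (induced_adj U) y z.
  by rewrite esym in xy; apply: connect_trans xz.
have lastU v q : path (induced_adj U) v q -> v \in U -> last v q \in U.
  by elim: q v => //= w q IHq v /andP[/and3P[_ wU _] wq] _; apply: IHq.
rewrite implyNb eq_sym; clear z zU xz xy.
elim: p y yU yp => [|w p IHp] y yU /=; first by rewrite eqxx.
case/andP=> /and3P[_ wU yw] wp.
have /orP[/eqP->|wl] := IHp w wU wp; first by rewrite yw orbT.
have [//|ly/=] := eqVneq; have lU := lastU _ _ wp wU.
by apply: (P3U y w) => //; rewrite eq_sym.
Qed.

Lemma IUCS U V : V \subset U -> IUC U -> IUC V.
Proof.
move=> /fintype.subsetP VU /IUCP UP; apply/IUCP => x y z xV yV zV.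
by apply: UP; apply: VU.
Qed.

Lemma stable_IUC U : stable U -> IUC U.
Proof.
move=> /forallP stU; apply/IUCP => x y z xU yU _ xy.
by have /implyP/(_ xU)/forallP/(_ y)/implyP/(_ yU) := stU x; rewrite xy.
Qed.

Lemma clique_IUC U : clique U -> IUC U.
Proof.
move=> /forallP clU; apply/IUCP => x y z xU _ zU _ _ xz.
by have /implyP/(_ xU)/forallP/(_ z)/implyP/(_ zU)/implyP := clU x; apply.
Qed.

Lemma edge_IUC (x y : G) : adj x y -> IUC ([set x; y]%SET : {set G}).
Proof.
move=> xy; apply: clique_IUC; apply/forallP => u; apply/implyP => uxy.
apply/forallP => v; apply/implyP => vxy; apply/implyP.
have := adj_sym x y; rewrite xy; move: uxy vxy; rewrite !inE.
by do 2![case/orP=> /eqP->]; rewrite ?eqxx.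
Qed.

End IUCGraphs.

(** * Convex sets and the cones over them *)

Section Convexity.
Variables (R : realType) (E : lmodType R) (C : set E).
Hypothesis convC : @convex_set R E C.

Lemma convex_setP (t : R) x y :
  0 <= t <= 1 -> C x -> C y -> C (t *: x + (1 - t) *: y).
Proof.
move=> t01 Cx Cy.
by have := convC (Itv01 (andP t01).1 (andP t01).2) (mem_set Cx) (mem_set Cy);
  rewrite inE.
Qed.

(* The cone over [C]: convex combinations become plain sums, with no
   normalization of the weights. *)
Definition dilate (t : R) : set E := [set t *: c | c in C].

(** The normalized weights [s / (s + t)] and [1 - s / (s + t)] reduce this to one convex
    combination. *)
Lemma dilateD s t p q : 0 <= s -> 0 <= t ->
  dilate s p -> dilate t q -> dilate (s + t) (p + q).
Proof.
move=> s0 t0 [c Cc <-] [d Cd <-].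
have [st0|st0] := eqVneq (s + t) 0.
  have [-> ->] : s = 0 /\ t = 0 by split; lra.
  by exists c; rewrite // addr0 !scale0r addr0.
have stp : 0 < s + t by rewrite lt_neqAle eq_sym st0 addr_ge0.
exists (s / (s + t) *: c + (1 - s / (s + t)) *: d).
  apply: convex_setP => //; rewrite divr_ge0 ?addr_ge0//=.
  by rewrite ler_pdivrMr// mul1r lerDl.
by rewrite scalerDr !scalerA mulrBr mulrCA divff// !mulr1 [s + t]addrC addrK.
Qed.

(** Nonemptiness of [C] serves the empty sum: 0 lies in [dilate 0] only if [C] has a point. *)
Lemma dilate_sum (T : finType) (A : {set T}) (w : T -> R) (F : T -> E) :
    C !=set0 -> (forall i, 0 <= w i) ->
    (forall i, i \in A -> C (F i)) ->
  dilate (\sum_(i in A) w i) (\sum_(i in A) w i *: F i).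
Proof.
move=> [c Cc] w0 CF.
suff [] : 0 <= \sum_(i in A) w i /\
   dilate (\sum_(i in A) w i) (\sum_(i in A) w i *: F i) by [].
apply: (big_ind2 (fun t p => 0 <= t /\ dilate t p)).
- by split=> //; exists c; rewrite ?scale0r.
- by move=> s p t q [s0 sp] [t0 tq]; split; [apply: addr_ge0|apply: dilateD].
- by move=> i iA; split=> //; exists (F i) => //; apply: CF.
Qed.

End Convexity.

(** * Cubes spanned by incidence vectors *)

Section Incidence.
Variables (R : realType) (G : sgraph) (C : set {ffun G -> R^o}).
Hypothesis convC : @convex_set R _ C.
Implicit Types (S : {set G}) (p : {ffun G -> R^o}).

(** Induction on the number of fractional coordinates: [p] lies on the segment between the two
    points obtained by rounding one of them to 0 and to 1. *)
Lemma cube_convex S p :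
    (forall V : {set G}, V \subset S -> C (incidence R V)) ->
    (forall v, 0 <= (p v : R) <= 1) -> (forall v, v \notin S -> p v = 0) ->
  C p.
Proof.
move=> CS; have [n] := ubnP #|[set v | (p v != 0) && (p v != 1)]%SET|.
elim: n p => // n IHn p; rewrite ltnS => pn p01 pS.
have [/setP frac0|[v]] := set_0Vmem [set v | (p v != 0) && (p v != 1)]%SET.
  have -> : p = incidence R [set v | p v == 1]%SET.
    apply/ffunP => v; rewrite ffunE inE.
    have := frac0 v; rewrite !inE.
    by case: eqVneq => [->|_]; case: eqVneq => //= ->.
  apply: CS; apply/fintype.subsetP => v; rewrite inE; apply: contraTT => /pS ->.
  by rewrite eq_sym oner_eq0.
rewrite inE => /andP[v0 v1].
pose q (a : R) : {ffun G -> R^o} := [ffun u => if u == v then a else p u].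
have Cq a : a = 0 \/ a = 1 -> C (q a).
  move=> a01; apply: IHn.
  - apply: leq_trans pn; apply: proper_card; apply/properP; split.
      apply/fintype.subsetP => u; rewrite !inE ffunE.
      by case: (u == v) => //; case: a01 => ->; rewrite eqxx ?andbF.
    exists v; first by rewrite inE v0 v1.
    rewrite inE ffunE eqxx.
    by case: a01 => ->; rewrite eqxx ?andbF.
  - move=> u; rewrite ffunE; case: eqP => // _.
    by case: a01 => ->; rewrite lexx ler01.
  - move=> u uS; rewrite ffunE; case: eqP => [uv|_]; last exact: pS.
    by move: v0; rewrite -uv pS ?eqxx.
have -> : p = (p v : R) *: q 1 + (1 - (p v : R)) *: q 0.
  apply/ffunP => u; rewrite !ffunE.
  case: eqP => [->|_]; rewrite /GRing.scale /=; lra.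
by apply: convex_setP => //; apply: Cq; [right|left].
Qed.

Lemma cube_dilate S (t : R) p :
    (forall V : {set G}, V \subset S -> C (incidence R V)) -> 0 <= t ->
    (forall v, 0 <= (p v : R) <= t) -> (forall v, v \notin S -> p v = 0) ->
  dilate C t p.
Proof.
move=> CS t0 pt pS; have [tz|tn0] := eqVneq t 0.
  (* The bounds force [p = 0], so any point of [C] will do. *)
  exists (incidence R finset.set0); first by apply: CS; apply: finset.sub0set.
  apply/ffunP => v; rewrite !ffunE tz scale0r.
  by apply/esym/(@le_anti _ R); rewrite andbC -{2}tz.
have tp : 0 < t by rewrite lt_neqAle eq_sym tn0.
exists (t^-1 *: p); last by rewrite scalerA divff// scale1r.
apply: (cube_convex CS) => v => [|vS]; last by rewrite ffunE pS// scaler0.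
have /andP[pv0 pvt] := pt v.
have -> : (t^-1 *: p) v = t^-1 * (p v : R) :> R by rewrite ffunE.
by rewrite mulr_ge0 ?invr_ge0//= mulrC ler_pdivrMr// mul1r.
Qed.

End Incidence.

(** * Validity of the double-star inequalities *)

Section DoubleStar.
Variables (R : realType) (G : sgraph).
Implicit Types (U L : {set G}) (h u : G).

Lemma double_starC h u L : double_star h u L -> double_star u h L.
Proof.
case/and5P=> hu ahu L2 stL /forallP hL; rewrite /double_star eq_sym hu adj_sym.
rewrite ahu L2 stL; apply/forallP => i; apply/implyP => iL.
by have /implyP/(_ iL) := hL i; rewrite andbC.
Qed.

(** Two leaves and a hub in [U] would induce a path on three vertices, as would both hubs and a
    leaf. So one hub allows at most one leaf and two hubs allow none; [2 <= #|L|] settles the case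
    of [u] alone. *)
Lemma double_star_incidence h u L U : double_star h u L -> IUC U ->
  (#|L :&: U|%SET + (#|L| - 1) * (h \in U) + (u \in U) <= #|L|)%N.
Proof.
case/and5P=> hu ahu L2 /forallP stL /forallP hL /IUCP UP.
have leaf v : v \in U -> {in L, forall i, adj v i} -> (#|L :&: U|%SET <= 1)%N.
  move=> vU vL; apply/card_le1_eqP => i j; rewrite !inE.
  case/andP=> iL iU /andP[jL jU]; apply/eqP.
  have /implyP/(_ iL)/forallP/(_ j)/implyP/(_ jL) := stL i.
  by apply: contraNT => ij; apply: (UP i v);
    rewrite // 1?eq_sym// ?vL// adj_sym vL.
have hLi i : i \in L -> adj h i by move=> iL; have /implyP/(_ iL)/andP[] := hL i.
have uLi i : i \in L -> adj u i by move=> iL; have /implyP/(_ iL)/andP[] := hL i.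
have LU : (#|L :&: U|%SET <= #|L|)%N by apply/subset_leq_card/subsetIl.
case hU: (h \in U); case uU: (u \in U) => /=; rewrite ?muln1 ?muln0 ?addn0.
- suff -> : (L :&: U)%SET = finset.set0 by rewrite cards0 add0n subnK// ltnW.
  apply/setP => i; rewrite !inE; apply/negP => /andP[iL iU]; move/negP: ahu.
  by apply; apply: (UP h i) => //; [apply: hLi|rewrite adj_sym; apply: uLi].
- by have := leaf h hU hLi; lia.
- by have := leaf u uU uLi; lia.
- exact: LU.
Qed.

Lemma incidence_double_star U : IUC U ->
  double_star_polyhedron R G (incidence R U).
Proof.
move=> UC; split=> [v|].
  by rewrite ffunE; case: (v \in U); rewrite lexx ler01.
(* The other inequality is this one with the hubs exchanged. *)
have half h u L : double_star h u L ->
  \sum_(i in L) (incidence R U i : R) + (#|L|%:R - 1) * (incidence R U h : R)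
   + (incidence R U u : R) <= #|L|%:R.
  move=> st; have := double_star_incidence st UC.
  rewrite -(ler_nat R) !natrD natrM natrB; last by case/and5P: st => _ _ /ltnW.
  congr (_ + _ * _ + _ <= _); rewrite ?ffunE//.
  rewrite -sum1_card natr_sum [RHS](big_setID U) /=.
  rewrite [X in _ = _ + X]big1 ?addr0 => [|i]; last first.
    by rewrite !inE ffunE => /andP[/negPf->].
  by apply: eq_bigr => i; rewrite inE ffunE => /andP[_ ->].
by move=> h u L st; split; [|rewrite addrAC]; apply: half => //;
  apply: double_starC.
Qed.

Lemma double_star_polyhedron_convex :
  @convex_set R _ (double_star_polyhedron R G).
Proof.
move=> x y t; rewrite !inE => -[x01 xst] [y01 yst].
set k : R := t%:num; have k0 : 0 <= k by apply: (ge0 t).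
have k1 : 0 <= 1 - k by rewrite subr_ge0; apply: (le1 t).
have zE v : (conv t x y : {ffun G -> R^o}) v =
    k * (x v : R) + (1 - k) * (y v : R) :> R by rewrite !ffunE.
have comb (a b c : R) : a <= c -> b <= c -> k * a + (1 - k) * b <= c.
  by move=> ac bc; have := ler_wpM2l k0 ac; have := ler_wpM2l k1 bc; lra.
split=> [v|h u L st].
  have /andP[? ?] := x01 v; have /andP[? ?] := y01 v.
  by rewrite zE comb// andbT addr_ge0// mulr_ge0.
have [xa xb] := xst h u L st; have [ya yb] := yst h u L st.
have sE : \sum_(i in L) ((conv t x y : {ffun G -> R^o}) i : R) =
   k * (\sum_(i in L) (x i : R)) + (1 - k) * (\sum_(i in L) (y i : R)).
  by rewrite !mulr_sumr -big_split; apply: eq_bigr => i _; rewrite zE.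
rewrite /double_star_ineqs sE !zE; split.
  by apply: le_trans (comb _ _ _ xa ya); rewrite le_eqVlt; apply/orP; left;
    apply/eqP; lra.
by apply: le_trans (comb _ _ _ xb yb); rewrite le_eqVlt; apply/orP; left;
  apply/eqP; lra.
Qed.

End DoubleStar.

(** * IUCs and double stars in complete bipartite graphs *)

Section CompleteBipartite.
Variables (G : sgraph) (I J : {set G}).
Hypothesis bipIJ : complete_bipartite I J.

Lemma complete_bipartiteC : complete_bipartite J I.
Proof.
case: bipIJ => UIJ dIJ adjE; split; first by rewrite finset.setUC.
- by rewrite disjoint_sym.
- by move=> x y; rewrite adjE orbC.
Qed.

Lemma bipartite_notin v : (v \in J) = (v \notin I).
Proof.
case: bipIJ => UIJ dIJ _; apply/idP/idP => [vJ|vI].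
  by apply/negP => /(disjointFr dIJ); rewrite vJ.
by have := finset.in_setT v; rewrite -UIJ inE (negPf vI).
Qed.

Lemma bipartite_adj : {in I & J, forall i j, adj i j}.
Proof. by case: bipIJ => _ _ adjE i j iI jJ; rewrite adjE iI jJ. Qed.

Lemma bipartite_nadj : {in I &, forall i i', ~~ adj i i'}.
Proof.
case: bipIJ => _ _ adjE i i' iI i'I.
by rewrite adjE !bipartite_notin iI i'I.
Qed.

Lemma sub_part_IUC (V : {set G}) : V \subset I -> IUC V.
Proof.
move=> VI; apply: (IUCS VI); apply: stable_IUC.
apply/forallP => i; apply/implyP => iI; apply/forallP => j; apply/implyP => jI.
exact: bipartite_nadj.
Qed.

Lemma bipartite_double_star h u (L : {set G}) :
    h \in I -> u \in I -> h != u -> L \subset J -> (2 <= #|L|)%N ->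
  double_star h u L.
Proof.
move=> hI uI hu /fintype.subsetP LJ L2; apply/and5P; split=> //.
- exact: bipartite_nadj.
- apply/forallP => i; apply/implyP => iL; apply/forallP => j; apply/implyP => jL.
  case: bipIJ => _ _ adjE; rewrite adjE.
  by move: (LJ i iL) (LJ j jL); rewrite !bipartite_notin => /negPf-> /negPf->.
- by apply/forallP => i; apply/implyP => /LJ iJ; rewrite !bipartite_adj.
Qed.

End CompleteBipartite.

(** * Convex decomposition with all edges through one vertex *)

Section Hub.
Variables (R : realType) (G : sgraph) (I J : {set G}).
Hypothesis bipIJ : complete_bipartite I J.
Variable C : set {ffun G -> R^o}.
Hypothesis convC : @convex_set R _ C.
Hypothesis CIUC : forall U : {set G}, IUC U -> C (incidence R U).

(** The last hypothesis is the case assumption under which edges through [i1] suffice. Here [i2] is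
    any second vertex of [I]; it yields [w <= x i1]. *)
Lemma hub_decomposition (x : {ffun G -> R^o}) (i1 i2 : G) :
    double_star_polyhedron R G x -> i1 \in I -> i2 \in I -> i2 != i1 ->
    (forall i, i \in I -> (x i : R) <= x i1) ->
    (forall i j, i \in I -> i != i1 -> j \in J -> (x i : R) + x j <= 1) ->
  C x.
Proof.
move=> [x01 xst] i1I i2I i21 xmax xij.
have x0 v : 0 <= (x v : R) by case/andP: (x01 v).
have x1 v : (x v : R) <= 1 by case/andP: (x01 v).
(* Subsets of [J] get total weight [1 - x i1]; the excess of [x j] over it must be carried by the
   edge [{i1, j}]. *)
pose b v : R := Num.max 0 ((x v : R) - (1 - (x i1 : R))).
have b0 v : 0 <= b v by rewrite le_max lexx.
have bx v : b v <= x v by rewrite ge_max x0 /=; have := x1 i1; lra.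
have xb v : (x v : R) - b v <= 1 - (x i1 : R).
  have : (x v : R) - (1 - (x i1 : R)) <= b v by rewrite le_max lexx orbT.
  by lra.
pose w := \sum_(j in J) b j.
have wx i : i \in I -> i != i1 -> w <= (x i1 : R) - (x i : R).
  move=> iI ii1; have i1i : i1 != i by rewrite eq_sym.
  pose L := [set j in J | 0 < b j]%SET.
  have bL j : j \in L -> b j = (x j : R) - (1 - (x i1 : R)).
    by rewrite inE lt_max ltxx => /andP[_ /ltW/max_idPr].
  have -> : w = \sum_(j in L) (x j : R) - #|L|%:R * (1 - (x i1 : R)).
    rewrite mulr_natl -sumr_const -sumrB -(eq_bigr _ bL) /w.
    rewrite (bigID (fun j => 0 < b j)) /= [X in _ + X]big1 ?addr0.
      by apply: eq_bigl => j; rewrite inE.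
    by move=> j /andP[_]; rewrite -leNgt => bj; apply/le_anti; rewrite bj b0.
  have LJ : L \subset J by apply/fintype.subsetP => j; rewrite inE => /andP[].
  have [L2|] := leqP 2 #|L|.
    (* The inequality in which [i1] has the coefficient [#|L| - 1] is the claim rearranged. *)
    have [+ _] := xst _ _ _ (bipartite_double_star bipIJ i1I iI i1i LJ L2).
    by lra.
  (* With a single leaf [j] the claim reads [x i + x j <= 1]; with none it is the maximality of
     [x i1]. *)
  rewrite ltnS leq_eqVlt ltnS leqn0 => /orP[/cards1P[j Lj]|/eqP L0].
    have jJ : j \in J by apply: (fintype.subsetP LJ); rewrite Lj finset.set11.
    rewrite Lj cards1 big_set1; have := xij i j iI ii1 jJ; lra.
  have -> : L = finset.set0 by apply/eqP; rewrite -cards_eq0 L0.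
  by rewrite cards0 big_set0; have := xmax i iI; lra.
have w0 : 0 <= w by apply: sumr_ge0.
have wx1 : w <= x i1 by have := wx i2 i2I i21; have := x0 i2; lra.
pose e j := incidence R [set i1; j]%SET.
(* [pI] and [pJ] are what remains of [x] on each side once the weighted edges are subtracted; on [I]
   only [i1] loses weight. *)
pose pI : {ffun G -> R^o} := [ffun v => if v \in I then
  if v == i1 then (x i1 : R) - w else (x v : R) else 0].
pose pJ : {ffun G -> R^o} := [ffun v => if v \in J then (x v : R) - b v else 0].
have JE := bipartite_notin bipIJ.
have -> : x = \sum_(j in J) b j *: e j + pI + pJ.
  apply/ffunP => v; rewrite !ffunE sum_ffunE.
  have -> : \sum_(j in J) (b j *: e j) v =
      if v == i1 then w else if v \in J then b v else 0.
    case: eqP => [->|/eqP vi1].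
      by apply: eq_bigr => j _; rewrite !ffunE !inE eqxx [_ *: _]mulr1.
    case: ifPn => vJ; last first.
      apply: big1 => j jJ; rewrite !ffunE !inE (negPf vi1) /=.
      case: eqP => [vj|_]; last exact: mulr0.
      by rewrite vj jJ in vJ.
    rewrite (bigD1 v) //= big1 ?addr0 => [|j /andP[jJ jv]].
      by rewrite !ffunE !inE eqxx orbT [_ *: _]mulr1.
    by rewrite !ffunE !inE (negPf vi1) eq_sym (negPf jv) [_ *: _]mulr0.
  rewrite JE; case: eqP => [->|_]; first by rewrite i1I /= addr0 addrC subrK.
  by case: (v \in I) => /=; rewrite ?addr0 ?add0r// addrC subrK.
(* The three weights, for edges, subsets of [I] and subsets of [J], add up to 1. *)
have : dilate C (w + (x i1 - w) + (1 - x i1))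
    (\sum_(j in J) b j *: e j + pI + pJ).
  apply: dilateD => //; [by rewrite addrC subrK|by rewrite subr_ge0| |].
    apply: dilateD => //; [by rewrite subr_ge0| |].
      apply: dilate_sum => //.
        (* [e i1] is the incidence vector of the singleton [{i1}] and only shows that [C] is
           nonempty. *)
        exists (e i1); apply: CIUC; rewrite /= finset.setUid.
        by apply: (sub_part_IUC bipIJ); rewrite finset.sub1set.
      move=> j jJ; apply: CIUC; apply: edge_IUC; exact: (bipartite_adj bipIJ).
    apply: (cube_dilate convC (S := I)) => // [V VI||v|v vI].
    - by apply: CIUC; apply: (sub_part_IUC bipIJ).
    - by rewrite subr_ge0.
    - rewrite ffunE; case: ifP => vI; last by rewrite lexx subr_ge0.
      case: eqP => [_|/eqP vi1]; first by rewrite subr_ge0 wx1 lexx.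
      by rewrite x0 /=; have := wx v vI vi1; lra.
    - by rewrite ffunE (negPf vI).
  apply: (cube_dilate convC (S := J)) => // [V VJ||v|v vJ].
  - by apply: CIUC; apply: (sub_part_IUC (complete_bipartiteC bipIJ)).
  - by rewrite subr_ge0.
  - by rewrite ffunE; case: ifP => _;
      [rewrite subr_ge0 bx xb|rewrite lexx subr_ge0 x1].
  - by rewrite ffunE (negPf vJ).
have -> : w + ((x i1 : R) - w) + (1 - (x i1 : R)) = 1 by lra.
by case=> c Cc <-; rewrite scale1r.
Qed.

End Hub.

(** * The two inclusions between polytope and polyhedron *)

Theorem theorem12 (R : realType) (G : sgraph) (I J : {set G})
    (bipIJ : complete_bipartite I J)
    (hI : #|I| = 1%N -> (#|J| <= 1)%N)
    (hJ : #|J| = 1%N -> (#|I| <= 1)%N) :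
  IUC_polytope R G = double_star_polyhedron R G.
Proof.
apply/seteqP; split.
  apply: smallest_sub; first exact: double_star_polyhedron_convex.
  by move=> _ [U UC <-]; apply: incidence_double_star.
(* The hull is a smallest set, so [x] must be found in an arbitrary convex [C] containing the
   incidence vectors. *)
move=> x xP C [convC CU].
have {CU} CIUC (U : {set G}) : IUC U -> C (incidence R U).
  by move=> UC; apply: CU; exists U.
(* If all vertex sets are IUCs, the bounds alone describe the hull, which is the full cube. This
   covers an empty part and a single edge. *)
have allIUC : (forall V : {set G}, IUC V) -> C x.
  move=> IUCV; apply: (cube_convex convC (S := [set: G]%SET)) => [V _|v|v].
  - exact: CIUC.
  - by case: xP => + _; apply.
  - by rewrite finset.in_setT.
have [UIJ dIJ adjE] := bipIJ; have bipJI := complete_bipartiteC bipIJ.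
have [I0|/set0Pn[i0 i0I]] := eqVneq I finset.set0.
  apply: allIUC => V; apply: (sub_part_IUC bipJI).
  by rewrite -[J]finset.set0U -I0 UIJ finset.subsetT.
have [J0|/set0Pn[j0 j0J]] := eqVneq J finset.set0.
  apply: allIUC => V; apply: (sub_part_IUC bipIJ).
  by rewrite -[I]finset.setU0 -J0 UIJ finset.subsetT.
(* [hI] and [hJ] exclude stars with two or more leaves, which contain no double star although their
   full vertex set is not an IUC. A singleton part thus leaves only a single edge. *)
have [IJ1|] := boolP ((#|I| == 1%N) || (#|J| == 1%N)).
  have [/cards1P[i Ii] /cards1P[j Jj]] : #|I| == 1%N /\ #|J| == 1%N.
    have I_gt0 : (0 < #|I|)%N by rewrite card_gt0; apply/set0Pn; exists i0.
    have J_gt0 : (0 < #|J|)%N by rewrite card_gt0; apply/set0Pn; exists j0.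
    by case/orP: IJ1 => /eqP c1; [have := hI c1|have := hJ c1]; lia.
  have ij : adj i j by apply: (bipartite_adj bipIJ); rewrite ?Ii ?Jj finset.set11.
  apply: allIUC => V; apply: IUCS (edge_IUC ij).
  by rewrite -Ii -Jj UIJ finset.subsetT.
case/norP=> I1 J1.
have second (K : {set G}) k : #|K| != 1%N -> k \in K ->
    exists2 k', k' \in K & k' != k.
  move=> K1 kK; have : (1 < #|K|)%N.
    by rewrite ltn_neqAle eq_sym K1 card_gt0; apply/set0Pn; exists k.
  rewrite (cardsD1 k) kK ltnS card_gt0 => /set0Pn[k'].
  by rewrite !inE => /andP[k'k k'K]; exists k'.
pose F v : R := x v.
case: (arg_maxP F i0I) => i1 i1I maxi; case: (arg_maxP F j0J) => j1 j1J maxj.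
have [i2 i2I i21] := second _ _ I1 i1I.
have [j2 j2J j21] := second _ _ J1 j1J.
have [/forallP hubI|] := boolP [forall i in I, (i != i1) ==> (F i + F j1 <= 1)].
  apply: (hub_decomposition bipIJ convC CIUC xP i1I i2I i21 maxi).
  move=> i j iI ii1 jJ; have /implyP/(_ iI)/implyP/(_ ii1) := hubI i.
  have : F j <= F j1 := maxj j jJ.
  by rewrite /F; lra.
rewrite negb_forall => /existsP[i]; rewrite !negb_imply -ltNge.
case/and3P=> iI ii1 lti.
(* With hubs [j1], [j] and leaves [i1], [i] all coefficients are 1. As [x i + x j1 > 1], this leaves
   [x i1 + x j < 1], and [x i' <= x i1]. *)
apply: (hub_decomposition bipJI convC CIUC xP j1J j2J j21 maxj) => j i' jJ jj1 i'I.
have L2 : #|[set i1; i]%SET| = 2%N by rewrite cards2 eq_sym ii1.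
have LI : [set i1; i]%SET \subset I by rewrite finset.subUset !finset.sub1set;
  apply/andP.
have j1j : j1 != j by rewrite eq_sym.
case: xP => _ xst.
have [+ _] := xst _ _ _ (bipartite_double_star bipJI j1J jJ j1j LI
  (eq_leq (esym L2))).
rewrite L2 big_setU1 ?inE 1?eq_sym// big_set1 /=.
have : F i' <= F i1 := maxi i' i'I.
by move: lti; rewrite /F; lra.
Qed.
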